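(* Let $P$ be the transition matrix of an irreducible reversible Markov chain on a finite set $\mathcal{X}$ of size $d$, with stationary distribution $\pi$, eigenvalues $1=\lambda_1>\lambda_2\ge\dots\ge\lambda_d\ge -1$ and associated left eigenvectors $u_1=\pi,u_2,\dots,u_d$, orthonormal for $\langle\cdot,\cdot\rangle_\pi$. Let $t\ge 0$ be an integer, let $\delta\in(0,1/4)$, and let $\mu\neq\mu'$ be two probability distributions on $\mathcal{X}$ such that $\mu,\mu',\pi$ pairwise have $\varepsilon$-bounded likelihood-ratios for some $\varepsilon\in(0,1)$. If $$ n \;\le\; \frac{8\,\varepsilon\,\delta^2}{\sum_{i=2}^d \lambda_i^{2t}\big(\langle u_i,\mu\rangle_\pi-\langle u_i,\mu'\rangle_\pi\big)^2}, $$ then every test $\psi:\mathcal{X}^n\to\{\mu,\mu'\}$ based on $n$ i.i.d. observations after $t$ steps of the chain satisfies $$ \max\Big\{\mathbf{P}_{\mu_t}^{\otimes n}(\psi\neq\mu),\ \mathbf{P}_{\mu'_t}^{\otimes n}(\psi\neq\mu')\Big\}\ \ge\ \tfrac12-\delta . $$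
   Context: Conventions: $P_{xy}$ is the probability of moving from $x$ to $y$; distributions are row vectors; $\mu_t=\mu P^t$ and $\mu'_t=\mu'P^t$. Reversible means $\pi_xP_{xy}=\pi_yP_{yx}$ for all $x,y$. The inner product on $\mathbb{R}^{\mathcal{X}}$ is $\langle u,u'\rangle_\pi=\sum_{x}u_xu'_x/\pi_x$. The left eigenvectors satisfy $u_iP=\lambda_iu_i$. By convention $0^0=1$, and a quotient with zero denominator and positive numerator equals $+\infty$. Two distributions $\mu,\mu'$ on $\mathcal{X}$ have an $\varepsilon$-bounded likelihood-ratio if $\varepsilon\le\mu_x/\mu'_x\le1/\varepsilon$ for all $x\in\mathcal{X}$. The observations $X_1,\dots,X_n$ are i.i.d. from $\nu_t$, where $\nu\in\{\mu,\mu'\}$ is unknown; $\mathbf{P}^{\otimes n}_{\nu_t}$ denotes probability under this law, and $\psi$ is evaluated at $(X_1,\dots,X_n)$. *)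

(* Defs.v *)
(* MathComp-Analysis world; the real numbers are an arbitrary [R : realType]. *)
From HB Require Import structures.
From mathcomp Require Import all_boot all_order all_algebra.
From mathcomp Require Import reals constructive_ereal.

Set Implicit Arguments.
Unset Strict Implicit.
Unset Printing Implicit Defensive.

Import Order.TTheory GRing.Theory Num.Theory.

Local Open Scope ring_scope.

Section MarkovChains.
Variables (R : realType) (X : finType).
Implicit Types (P : X -> X -> R) (mu nu pi u v : {ffun X -> R}).

Definition distribution mu : Prop :=
  (forall x, 0 <= mu x) /\ \sum_x mu x = 1.

Definition transition_matrix P : Prop :=
  (forall x y, 0 <= P x y) /\ (forall x, \sum_y P x y = 1).

(* Matrix power, written out because MathComp matrices are indexed by ordinals
   rather than by an arbitrary finite type. *)
Fixpoint kpow P (t : nat) : X -> X -> R :=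
  if t is s.+1 then fun x y => \sum_z kpow P s x z * P z y
  else fun x y => (x == y)%:R.

Definition lmul u P : {ffun X -> R} := [ffun y => \sum_x u x * P x y].

Definition evolve mu P (t : nat) : {ffun X -> R} := lmul mu (kpow P t).

Definition irreducible_chain P : Prop :=
  forall x y, exists t, 0 < kpow P t x y.

Definition reversible P pi : Prop :=
  forall x y, pi x * P x y = pi y * P y x.

Definition stationary P pi : Prop := distribution pi /\ lmul pi P = pi.

Definition inner pi u v : R := \sum_x u x * v x / pi x.

(* Indices start at 0: [lambda i] and [u i] with [i < d] stand for
   lambda_{i+1} and u_{i+1}. *)
Record spectral_data P pi (d : nat)
    (lambda : 'I_d -> R) (u : 'I_d -> {ffun X -> R}) : Prop := SpectralData {
  spec_left_eigen : forall i, lmul (u i) P = [ffun x => lambda i * u i x];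
  spec_orthonormal : forall i j, inner pi (u i) (u j) = (i == j)%:R;
  spec_first_value : forall i : 'I_d, i = 0%N :> nat -> lambda i = 1;
  spec_first_vector : forall i : 'I_d, i = 0%N :> nat -> u i = pi;
  spec_gap : forall i : 'I_d, (0 < i)%N -> lambda i < 1;
  spec_sorted : forall i j : 'I_d, (i <= j)%N -> lambda j <= lambda i;
  spec_lower : forall i, -1 <= lambda i
}.

(* Division in [\bar R] satisfies a / 0 = +oo for a > 0, as desired. It also
   gives 0 / 0 = 0, so a pair vanishing at a common point is rejected. *)
Definition bounded_likelihood_ratio (eps : R) mu nu : Prop :=
  forall x, (eps%:E <= (mu x)%:E / (nu x)%:E <= (1 / eps)%:E)%E.

Definition iid_prob nu (n : nat) (A : pred (n.-tuple X)) : R :=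
  \sum_(w : n.-tuple X | A w) \prod_(i < n) nu (tnth w i).

End MarkovChains.

(* Main.v *)
Require Import Defs.
From HB Require Import structures.
From mathcomp Require Import all_boot all_order all_algebra.
From mathcomp Require Import reals constructive_ereal.
From mathcomp Require Import ring lra.

Set Implicit Arguments.
Unset Strict Implicit.
Unset Printing Implicit Defensive.

Import Order.TTheory GRing.Theory Num.Theory.
Local Open Scope ring_scope.

(** Two samples cannot be told apart when their laws nearly coincide, and the
    laws of the chain after [t] steps coincide up to the modes that have not yet
    decayed; the number of observations enters through the Hellinger affinity,
    which is multiplicative over independent samples.

    Testing.  Write [o] for the overlap [\sum_w min] of the two sample laws, that
    is one minus their total variation distance.  On each sample a test errs
    under one of the two hypotheses, so its two error probabilities add up to at
    least [o] and the larger one is at least [o / 2] ([overlap_le_errors]); it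
    remains to bound [o] below by [1 - 2 * delta].  With [A] the affinity
    [\sum_x sqrt (p x * q x)] of the one-observation laws, that of the sample
    laws is [A ^+ n], and Cauchy-Schwarz applied to min and max gives
    [A ^+ (2 * n) <= o * (2 - o)], that is
    [(1 - o) ^+ 2 <= 1 - A ^+ (2 * n) <= 2 * n * (1 - A)]
    ([affinity_sqr_le_overlap], [sqr_one_sub_overlap_le]).  Finally [1 - A] is
    half of [\sum_x (sqrt (p x) - sqrt (q x)) ^+ 2], which is at most
    [\sum_x (p x - q x) ^+ 2 / (8 * h x)] when [p] and [q] both dominate [h]
    ([one_sub_affinity_le]).  These bounds combine in [test_error_ge].

    Chain.  Since [mu] and [mu'] dominate [eps * pi] and [pi] is stationary, so
    do the laws at time [t]: one may take [h = eps * pi] ([evolve_ge_stationary]).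
    The sum above is then, up to a constant, the squared [pi]-norm of
    [(mu - mu') P ^ t].  Reversibility makes [P] self-adjoint for the inner
    product and the [#|X|] orthonormal eigenvectors form a basis, so Parseval
    turns this norm into the spectral sum; the first mode vanishes as
    [mu] and [mu'] have the same mass ([inner_evolve_spectral]). *)

(** * Affinity, overlap and testing error *)

Section Affinity.
Context {R : realType}.

Definition affinity {T : finType} (f g : T -> R) : R :=
  \sum_x Num.sqrt (f x) * Num.sqrt (g x).

Definition overlap {T : finType} (f g : T -> R) : R :=
  \sum_x Num.min (f x) (g x).

Definition likelihood {X : finType} (n : nat) (f : X -> R) (w : n.-tuple X) : R :=
  \prod_(i < n) f (tnth w i).
Arguments likelihood {X} n f w.

Lemma sum_likelihood (X : finType) (n : nat) (f : X -> R) :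
  \sum_(w : n.-tuple X) likelihood n f w = (\sum_x f x) ^+ n.
Proof.
rewrite -[in RHS](card_ord n) -prodr_const bigA_distr_bigA /=.
rewrite (reindex (fun h : {ffun 'I_n -> X} => [tuple h i | i < n])) /=; last first.
  exists (fun w : n.-tuple X => [ffun i => tnth w i]) => w _.
    by apply/ffunP => i; rewrite ffunE tnth_mktuple.
  by apply: eq_from_tnth => i; rewrite tnth_mktuple ffunE.
by apply: eq_bigr => h _; apply: eq_bigr => i _; rewrite tnth_mktuple.
Qed.

Lemma likelihood_ge0 (X : finType) (n : nat) (f : X -> R) (w : n.-tuple X) :
  (forall x, 0 <= f x) -> 0 <= likelihood n f w.
Proof. by move=> f0; apply: prodr_ge0. Qed.

Lemma sqrt_prod (I : finType) (f : I -> R) : (forall i, 0 <= f i) ->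
  Num.sqrt (\prod_i f i) = \prod_i Num.sqrt (f i).
Proof.
move=> f0; suff [_ ->] : 0 <= \prod_i f i /\
    Num.sqrt (\prod_i f i) = \prod_i Num.sqrt (f i) by [].
apply: (big_ind2 (fun a b => 0 <= a /\ Num.sqrt a = b)).
- by rewrite sqrtr1.
- by move=> a _ b _ [a0 <-] [b0 <-]; rewrite sqrtrM // mulr_ge0.
- by [].
Qed.

Lemma affinity_likelihood (X : finType) (n : nat) (f g : X -> R) :
  (forall x, 0 <= f x) -> (forall x, 0 <= g x) ->
  affinity (likelihood n f) (likelihood n g) = affinity f g ^+ n.
Proof.
move=> f0 g0; rewrite -sum_likelihood; apply: eq_bigr => w _.
by rewrite /likelihood !sqrt_prod // -big_split.
Qed.

(** The difference of the two sides is half of Lagrange's sum of squares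
    [\sum_x \sum_y (a x * b y - a y * b x) ^+ 2]. *)
Lemma cauchy_schwarz (T : finType) (a b : T -> R) :
  (\sum_x a x * b x) ^+ 2 <= (\sum_x a x ^+ 2) * (\sum_x b x ^+ 2).
Proof.
have sumsq : 0 <= \sum_x \sum_y (a x * b y - a y * b x) ^+ 2.
  by apply: sumr_ge0 => x _; apply: sumr_ge0 => y _; exact: sqr_ge0.
have dist (f g : T -> R) :
    (\sum_x f x) * (\sum_y g y) = \sum_x \sum_y f x * g y.
  by rewrite mulr_suml; apply: eq_bigr => x _; rewrite mulr_sumr.
suff lagrange : \sum_x \sum_y (a x * b y - a y * b x) ^+ 2 =
  2 * ((\sum_x a x ^+ 2) * (\sum_x b x ^+ 2)) - 2 * (\sum_x a x * b x) ^+ 2.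
  by move: sumsq; rewrite lagrange; lra.
set A := \sum_x a x ^+ 2; set B := \sum_x b x ^+ 2; set C := \sum_x a x * b x.
transitivity (A * B + B * A - 2 * (C * C)); last by ring.
rewrite !dist mulr_sumr -big_split -sumrB /=.
apply: eq_bigr => x _; rewrite mulr_sumr -big_split -sumrB /=.
by apply: eq_bigr => y _; ring.
Qed.

(** Cauchy-Schwarz with [f x * g x = min * max]: the minima add up to the overlap
    and, the total mass being 2, the maxima add up to [2 - overlap f g]. *)
Lemma affinity_sqr_le_overlap (T : finType) (f g : T -> R) :
  (forall x, 0 <= f x) -> (forall x, 0 <= g x) ->
  \sum_x f x = 1 -> \sum_x g x = 1 ->
  affinity f g ^+ 2 <= overlap f g * (2 - overlap f g).
Proof.
move=> f0 g0 f1 g1.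
have min0 x : 0 <= Num.min (f x) (g x) by rewrite le_min f0 g0.
have max0 x : 0 <= Num.max (f x) (g x) by rewrite le_max f0.
have -> : 2 - overlap f g = \sum_x Num.max (f x) (g x).
  rewrite (_ : 2 = \sum_x (f x + g x)); last by rewrite big_split /= f1 g1.
  by rewrite -sumrB; apply: eq_bigr => x _; rewrite -(addr_max_min (f x)) addrK.
have -> : affinity f g =
    \sum_x Num.sqrt (Num.min (f x) (g x)) * Num.sqrt (Num.max (f x) (g x)).
  apply: eq_bigr => x _; case: (leP (f x) (g x)) => // _; exact: mulrC.
apply: le_trans (cauchy_schwarz _ _) _.
by rewrite le_eqVlt; apply/orP; left; apply/eqP; congr (_ * _);
  apply: eq_bigr => x _; rewrite sqr_sqrtr.
Qed.

Lemma affinity_ge0 (T : finType) (f g : T -> R) : 0 <= affinity f g.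
Proof. by apply: sumr_ge0 => x _; rewrite mulr_ge0 ?sqrtr_ge0. Qed.

(** The left side is [(sqrt a - sqrt b) ^+ 2 / 2], and [(a - b) ^+ 2] is that
    square times [(sqrt a + sqrt b) ^+ 2 >= 4 * c]. *)
Lemma mean_sub_sqrt_le (a b c : R) : 0 < c -> c <= a -> c <= b ->
  (a + b) / 2 - Num.sqrt a * Num.sqrt b <= (a - b) ^+ 2 / (8 * c).
Proof.
move=> c0 ca cb; have a0 : 0 <= a by lra.
have b0 : 0 <= b by lra.
rewrite ler_pdivlMr ?mulr_gt0 //.
have := sqr_sqrtr a0; have := sqr_sqrtr b0.
have : Num.sqrt c <= Num.sqrt a by rewrite ler_sqrt.
have : Num.sqrt c <= Num.sqrt b by rewrite ler_sqrt.
have := sqr_sqrtr (ltW c0); have := sqrtr_ge0 c.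
move: (Num.sqrt a) (Num.sqrt b) (Num.sqrt c) => s r k k0 kE kr ks rE sE.
rewrite -sE -rE -kE.
have k2 : (2 * k) ^+ 2 <= (s + r) ^+ 2 by apply: lerXn2r; rewrite ?nnegrE; lra.
have := ler_wpM2l (sqr_ge0 (s - r)) k2.
lra.
Qed.

Lemma one_sub_affinity_le (T : finType) (f g h : T -> R) :
  (forall x, 0 < h x) -> (forall x, h x <= f x) -> (forall x, h x <= g x) ->
  \sum_x f x = 1 -> \sum_x g x = 1 ->
  1 - affinity f g <= \sum_x (f x - g x) ^+ 2 / (8 * h x).
Proof.
move=> h0 hf hg f1 g1.
have mean1 : 1 = \sum_x (f x + g x) / 2.
  by rewrite -mulr_suml big_split /= f1 g1; lra.
by rewrite [X in X - _]mean1 -sumrB; apply: ler_sum => x _; apply: mean_sub_sqrt_le.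
Qed.

(** Bernoulli's inequality, in the form that makes the loss of affinity grow at
    most linearly with the sample size. *)
Lemma one_sub_exp_le (a : R) (n : nat) : 0 <= a <= 1 ->
  1 - a ^+ n <= n%:R * (1 - a).
Proof.
case/andP=> a0 a1; elim: n => [|n IHn]; first by rewrite expr0; lra.
rewrite exprS -natr1; have := ler_wpM2l a0 IHn.
have := ler_wpM2r (_ : 0 <= n%:R * (1 - a)) a1.
by rewrite mul1r => /(_ ltac:(by rewrite mulr_ge0 ?subr_ge0)); lra.
Qed.

Lemma sqr_one_sub_overlap_le (X : finType) (n : nat) (f g : X -> R) :
  (forall x, 0 <= f x) -> (forall x, 0 <= g x) ->
  \sum_x f x = 1 -> \sum_x g x = 1 ->
  (1 - overlap (likelihood n f) (likelihood n g)) ^+ 2 <= 2 * n%:R * (1 - affinity f g).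
Proof.
move=> f0 g0 f1 g1.
have A1 : affinity f g <= 1.
  have := affinity_sqr_le_overlap f0 g0 f1 g1.
  have := affinity_ge0 f g; have := sqr_ge0 (1 - overlap f g); nra.
have one (h : X -> R) : \sum_x h x = 1 -> \sum_w likelihood n h w = 1.
  by rewrite sum_likelihood => ->; rewrite expr1n.
have := affinity_sqr_le_overlap (fun w => likelihood_ge0 w f0)
  (fun w => likelihood_ge0 w g0) (one _ f1) (one _ g1).
rewrite affinity_likelihood // -exprM mulnC.
have : 1 - affinity f g ^+ (2 * n) <= (2 * n)%:R * (1 - affinity f g).
  by apply: one_sub_exp_le; rewrite affinity_ge0.
by rewrite natrM; lra.
Qed.

(** Pointwise: the test's verdict on [w] cannot be both [a] and [b], so the
    likelihood of [w] under at least one hypothesis counts as an error. *)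
Lemma overlap_le_errors (X : finType) (n : nat) (p q a b : {ffun X -> R})
    (psi : n.-tuple X -> {ffun X -> R}) :
  (forall x, 0 <= p x) -> (forall x, 0 <= q x) -> a <> b ->
  overlap (likelihood n p) (likelihood n q) <=
    iid_prob p (fun w : n.-tuple X => psi w != a) +
    iid_prob q (fun w : n.-tuple X => psi w != b).
Proof.
move=> p0 q0 ab; rewrite /iid_prob big_mkcond [X in _ + X]big_mkcond -big_split /=.
apply: ler_sum => w _.
have P0 := likelihood_ge0 w p0; have Q0 := likelihood_ge0 w q0.
rewrite -![\prod_(i < n) _]/(likelihood n _ w).
have [-> | _] := eqVneq (psi w) a.
  have /eqP/negPf -> /= := ab.
  by rewrite add0r ge_min lexx orbT.
by rewrite ge_min /=; case: ifP => _; rewrite lerDl ?lexx ?Q0.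
Qed.

(** [delta] bounds half the total variation distance between the sample laws:
    the constant 16 is 8, from [one_sub_affinity_le], times 2, from
    [(2 * delta) ^+ 2 = 2 * (2 * delta ^+ 2)] in [sqr_one_sub_overlap_le]. *)
Lemma test_error_ge (X : finType) (n : nat) (p q a b : {ffun X -> R})
    (h : X -> R) (delta : R) (psi : n.-tuple X -> {ffun X -> R}) :
  (forall x, 0 < h x) -> (forall x, h x <= p x) -> (forall x, h x <= q x) ->
  \sum_x p x = 1 -> \sum_x q x = 1 -> 0 <= delta -> a <> b ->
  n%:R * (\sum_x (p x - q x) ^+ 2 / h x) <= 16 * delta ^+ 2 ->
  1 / 2 - delta <=
    Num.max (iid_prob p (fun w : n.-tuple X => psi w != a))
            (iid_prob q (fun w : n.-tuple X => psi w != b)).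
Proof.
move=> h0 hp hq p1 q1 delta0 ab nS.
have p0 x : 0 <= p x := le_trans (ltW (h0 x)) (hp x).
have q0 x : 0 <= q x := le_trans (ltW (h0 x)) (hq x).
have aff : 8 * (1 - affinity p q) <= \sum_x (p x - q x) ^+ 2 / h x.
  rewrite mulrC -ler_pdivlMr // mulr_suml.
  apply: le_trans (one_sub_affinity_le h0 hp hq p1 q1) _.
  by apply: ler_sum => x _; rewrite invfM mulrA mulrAC.
have naff : n%:R * (8 * (1 - affinity p q)) <= 16 * delta ^+ 2.
  by apply: le_trans nS; rewrite ler_wpM2l.
have ov := sqr_one_sub_overlap_le n p0 q0 p1 q1.
have err := overlap_le_errors psi p0 q0 ab.
set A := iid_prob p _ in err *; set B := iid_prob q _ in err *.
have leA : A <= Num.max A B by rewrite le_max lexx.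
have leB : B <= Num.max A B by rewrite le_max lexx orbT.
have overlap_ge : 1 - 2 * delta <= overlap (likelihood n p) (likelihood n q).
  move: (overlap _ _) (affinity p q) ov naff => o s {err}.
  by clear -delta0 => ov naff; rewrite leNgt; apply/negP => lt_o; nra.
by move: leA leB err overlap_ge; clear; lra.
Qed.

End Affinity.

(** * Evolution of a reversible chain in an orthonormal eigenbasis *)

Section Spectral.
Context {R : realType} {X : finType}.
Implicit Types (P : X -> X -> R) (mu pi u v : {ffun X -> R}).

Lemma evolve0 mu P : evolve mu P 0 = mu.
Proof.
apply/ffunP => y; rewrite ffunE (bigD1 y) //= eqxx mulr1 big1 ?addr0 // => x.
by move=> /negPf ->; rewrite mulr0.
Qed.

Lemma evolveS mu P t : evolve mu P t.+1 = lmul (evolve mu P t) P.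
Proof.
apply/ffunP => y; rewrite !ffunE /=.
under eq_bigr do rewrite mulr_sumr.
rewrite exchange_big; apply: eq_bigr => z _ /=.
by rewrite ffunE mulr_suml; apply: eq_bigr => x _; rewrite mulrA.
Qed.

Lemma evolveB mu v P t : evolve (mu - v) P t = evolve mu P t - evolve v P t.
Proof.
apply/ffunP => y; rewrite !ffunE -sumrB.
by apply: eq_bigr => x _; rewrite !ffunE mulrBl.
Qed.

Lemma sum_evolve mu P t : transition_matrix P ->
  \sum_x evolve mu P t x = \sum_x mu x.
Proof.
case=> _ P1; elim: t => [|t IHt]; first by rewrite evolve0.
rewrite evolveS -IHt; under eq_bigr do rewrite ffunE.
by rewrite exchange_big; apply: eq_bigr => x _; rewrite /= -mulr_sumr P1 mulr1.
Qed.

(** The pointwise order is preserved by each step because [P] is nonnegative,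
    and the lower bound [c * pi] is a fixed point of the step. *)
Lemma evolve_ge_stationary mu pi P c t : transition_matrix P -> lmul pi P = pi ->
  (forall x, c * pi x <= mu x) -> forall x, c * pi x <= evolve mu P t x.
Proof.
move=> [P0 _] piP h; elim: t => [|t IHt] y; first by rewrite evolve0.
rewrite evolveS -{1}piP !ffunE mulr_sumr; apply: ler_sum => x _.
by rewrite mulrA ler_wpM2r.
Qed.

(** Detailed balance in the form [P x y / pi y = P y x / pi x]: the chain is
    self-adjoint for the weights [1 / pi]. *)
Lemma inner_lmul_sym pi P u v : (forall x, pi x != 0) -> reversible P pi ->
  inner pi u (lmul v P) = inner pi (lmul u P) v.
Proof.
move=> pi0 rev; rewrite /inner.
under eq_bigr do rewrite ffunE mulr_sumr mulr_suml.
rewrite exchange_big; apply: eq_bigr => x _ /=.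
rewrite ffunE 2!mulr_suml; apply: eq_bigr => y _.
have -> : P x y = pi y * P y x / pi x by rewrite -rev mulrC mulKf.
by field; rewrite !pi0.
Qed.

Lemma inner_eigen_evolve pi P u v (l : R) t :
  (forall x, pi x != 0) -> reversible P pi -> lmul u P = [ffun x => l * u x] ->
  inner pi u (evolve v P t) = l ^+ t * inner pi u v.
Proof.
move=> pi0 rev uP; elim: t => [|t IHt]; first by rewrite evolve0 mul1r.
rewrite evolveS inner_lmul_sym // uP exprS -mulrA -IHt /inner mulr_sumr.
by apply: eq_bigr => x _; rewrite ffunE !mulrA.
Qed.

(** Orthonormality says that a square matrix has a right inverse; the resolution
    of the identity is the same pair multiplied in the other order.  This is
    where having as many vectors as states matters. *)
Lemma orthonormal_complete pi (u : 'I_#|X| -> {ffun X -> R}) :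
  (forall i j, inner pi (u i) (u j) = (i == j)%:R) ->
  forall x y, \sum_i u i x * u i y / pi x = (x == y)%:R.
Proof.
move=> on x y.
pose A : 'M[R]_#|X| := \matrix_(i, k) u i (enum_val k).
pose B : 'M[R]_#|X| := \matrix_(k, i) (u i (enum_val k) / pi (enum_val k)).
have AB : A *m B = 1%:M.
  apply/matrixP => i j; rewrite !mxE -on /inner.
  rewrite [RHS](reindex_onto enum_val enum_rank) /=; last first.
    by move=> z _; rewrite enum_rankK.
  apply: eq_big => [k|k _]; first by rewrite enum_valK eqxx.
  by rewrite !mxE mulrA.
move/matrixP: (mulmx1C AB) => /(_ (enum_rank x) (enum_rank y)).
rewrite !mxE (inj_eq enum_rank_inj) => <-.
by apply: eq_bigr => i _; rewrite !mxE !enum_rankK mulrAC.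
Qed.

Lemma parseval pi (u : 'I_#|X| -> {ffun X -> R}) v :
  (forall i j, inner pi (u i) (u j) = (i == j)%:R) ->
  \sum_i inner pi (u i) v ^+ 2 = inner pi v v.
Proof.
move=> on.
have step i : inner pi (u i) v ^+ 2 =
    \sum_x \sum_y (u i x * u i y / pi x) * (v x * v y / pi y).
  rewrite expr2 /inner mulr_suml; apply: eq_bigr => x _.
  by rewrite mulr_sumr; apply: eq_bigr => y _; ring.
under eq_bigr do rewrite step.
rewrite exchange_big; apply: eq_bigr => x _ /=.
rewrite exchange_big /= (bigD1 x) //= -mulr_suml orthonormal_complete // eqxx.
rewrite mul1r big1 ?addr0 // => y; rewrite eq_sym => /negPf yx.
by rewrite -mulr_suml orthonormal_complete // yx mul0r.
Qed.

Lemma innerBr pi u v v' : inner pi u (v - v') = inner pi u v - inner pi u v'.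
Proof.
rewrite /inner -sumrB; apply: eq_bigr => x _.
by rewrite !ffunE mulrBr mulrBl.
Qed.

(** Parseval, where mode [i] has been multiplied by [lambda i ^+ t].  The mode of
    [pi] drops out: its coefficient is the total mass of [mu - mu']. *)
Lemma inner_evolve_spectral P pi d (lambda : 'I_d -> R)
    (u : 'I_d -> {ffun X -> R}) (mu mu' : {ffun X -> R}) t :
  #|X| = d -> reversible P pi -> (forall x, pi x != 0) ->
  spectral_data P pi lambda u -> \sum_x mu x = \sum_x mu' x ->
  inner pi (evolve (mu - mu') P t) (evolve (mu - mu') P t) =
  \sum_(i < d | (0 < i)%N)
     lambda i ^+ (2 * t) * (inner pi (u i) mu - inner pi (u i) mu') ^+ 2.
Proof.
move=> dX; subst d => rev pi0 hs eqm.
rewrite -(parseval _ (spec_orthonormal hs)) [RHS]big_mkcond /=.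
apply: eq_bigr => i _.
rewrite (inner_eigen_evolve _ _ pi0 rev (spec_left_eigen hs i)).
case: ifP => [_|i0]; first by rewrite innerBr exprMn -exprM mulnC.
rewrite (spec_first_vector hs); last by apply/eqP; rewrite -leqn0 leqNgt i0.
suff -> : inner pi pi (mu - mu') = 0 by rewrite mulr0 expr0n.
rewrite /inner (eq_bigr (fun x => mu x - mu' x)).
  by rewrite sumrB eqm subrr.
by move=> x _; rewrite !ffunE mulrC mulKf.
Qed.

End Spectral.

(** * Extended-real quotients *)

(** A zero of [pi] would make the ratio [0] or infinite, both outside
    [[eps, 1 / eps]]; so [pi] is positive and the ratio is an honest one. *)
Lemma bounded_likelihood_ratio_lower (R : realType) (X : finType) (eps : R) (mu pi : {ffun X -> R}) :
  0 < eps -> (forall x, 0 <= pi x) -> bounded_likelihood_ratio eps mu pi ->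
  forall x, 0 < pi x /\ eps * pi x <= mu x.
Proof.
move=> eps0 pi0 h x; move: (h x); rewrite inver.
have [_ | pin0] := eqVneq (pi x) 0.
  rewrite mulry; case: sgrP => _; rewrite ?mul0e ?mul1e ?mulN1e /=.
  - by rewrite lee_fin leNgt eps0.
  - by rewrite leye_eq andbF.
  - by [].
have pigt0 : 0 < pi x by rewrite lt_def pin0 pi0.
by rewrite -EFinM !lee_fin ler_pdivlMr // => /andP[].
Qed.

(** Clearing the denominator is safe even when it vanishes: the quotient may be
    infinite, but the product is then [0]. *)
Lemma le_ediv_mul (R : realType) (a c s : R) :
  0 <= c -> 0 <= s -> (a%:E <= c%:E / s%:E)%E -> a * s <= c.
Proof.
move=> c0 s0; rewrite inver; have [-> _ | sn0] := eqVneq s 0.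
  by rewrite mulr0.
by rewrite -EFinM lee_fin ler_pdivlMr // lt_def sn0.
Qed.

(** * The lower bound *)

Theorem theorem7 (R : realType) (X : finType) (d : nat) (hd : #|X| = d)
    (P : X -> X -> R) (pi : {ffun X -> R})
    (hP : transition_matrix P) (hirr : irreducible_chain P)
    (hpi : stationary P pi) (hrev : reversible P pi)
    (lambda : 'I_d -> R) (u : 'I_d -> {ffun X -> R})
    (hspec : spectral_data P pi lambda u)
    (t : nat) (delta : R) (hdelta : 0 < delta < 1 / 4)
    (mu mu' : {ffun X -> R})
    (hmu : distribution mu) (hmu' : distribution mu') (hneq : mu <> mu')
    (eps : R) (heps : 0 < eps < 1)
    (hmm' : bounded_likelihood_ratio eps mu mu')
    (hmpi : bounded_likelihood_ratio eps mu pi)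
    (hm'pi : bounded_likelihood_ratio eps mu' pi)
    (n : nat)
    (hn : (n%:R%:E <= (8 * eps * delta ^+ 2)%:E /
             (\sum_(i < d | (0 < i)%N)
                lambda i ^+ (2 * t) *
                (inner pi (u i) mu - inner pi (u i) mu') ^+ 2)%:E)%E)
    (psi : n.-tuple X -> {ffun X -> R})
    (hpsi : forall w, psi w = mu \/ psi w = mu') :
  1 / 2 - delta <=
    Num.max (iid_prob (evolve mu P t) (fun w : n.-tuple X => psi w != mu))
            (iid_prob (evolve mu' P t) (fun w : n.-tuple X => psi w != mu')).
Proof.
have [eps0 _] := andP heps; have [delta0 _] := andP hdelta.
have [[pi_ge0 _] piP] := hpi.
have pi_gt0 x : 0 < pi x by have [] := bounded_likelihood_ratio_lower eps0 pi_ge0 hmpi x.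
have lower_mu := evolve_ge_stationary t hP piP
  (fun x => (bounded_likelihood_ratio_lower eps0 pi_ge0 hmpi x).2).
have lower_mu' := evolve_ge_stationary t hP piP
  (fun x => (bounded_likelihood_ratio_lower eps0 pi_ge0 hm'pi x).2).
apply: (test_error_ge (h := fun x => eps * pi x)) => //.
- by move=> x; rewrite mulr_gt0.
- by rewrite sum_evolve // hmu.2.
- by rewrite sum_evolve // hmu'.2.
- exact: ltW.
set S := \sum_(i < d | _) _ in hn.
have SE : S = inner pi (evolve (mu - mu') P t) (evolve (mu - mu') P t).
  rewrite (inner_evolve_spectral _ hd hrev _ hspec) ?hmu.2 ?hmu'.2 //.
  by move=> x; rewrite gt_eqF.
have -> : \sum_x (evolve mu P t x - evolve mu' P t x) ^+ 2 / (eps * pi x) =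
    S / eps.
  rewrite SE evolveB /inner mulr_suml; apply: eq_bigr => x _.
  by rewrite !ffunE expr2 invfM [eps^-1 * _]mulrC mulrA.
have S_ge0 : 0 <= S.
  rewrite SE; apply: sumr_ge0 => x _.
  by rewrite -expr2 mulr_ge0 ?sqr_ge0 // invr_ge0 ltW.
have nS : n%:R * S <= 8 * eps * delta ^+ 2.
  by apply: le_ediv_mul hn => //; rewrite mulr_ge0 ?sqr_ge0 ?mulr_ge0 // ltW.
rewrite mulrA ler_pdivrMr //; apply: le_trans nS _.
rewrite mulrAC ler_wpM2r ?(ltW eps0) // ler_wpM2r ?sqr_ge0 //.
by rewrite ler_nat.
Qed.
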